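(* Let $k \ge 2$ be an integer and $\lambda>0$ a real number, both constant (independent of $n$). For $n\ge 1$ let $G_n=(V_n,E_n)$ be the complete $k$-ary tree of height $n$ with root $r$, and let $P_n$ be the transition matrix on $V_n$ given by $$P_n(u,v)=\begin{cases}\frac1k & \text{if } u=r \text{ and } v \text{ is a child of } u,\\ \frac{1}{\lambda+k} & \text{if } u\ne r \text{ and } v \text{ is a child of } u,\\ \frac{\lambda}{\lambda+k} & \text{if } u \text{ is an internal node, } u \neq r, \text{ and } v \text{ is the parent of } u,\\ 1 & \text{if } u \text{ is a leaf and } v \text{ is the parent of } u,\\ 0 & \text{otherwise.}\end{cases}$$ Let $\mathcal D_{\mathrm T}=(\mathfrak d,G,P)$ be the random walk on a growing graph with $G(n)=G_n$ and $P(n)=P_n$, started at $r$. Then $r$ is recurrent by $\mathcal D_{\mathrm T}$ if $$\sum_{n=1}^{\infty}\mathfrak d(n)\left(\frac{\lambda}{k}\right)^n=\infty,$$ and otherwise $r$ is transient by $\mathcal D_{\mathrm T}$.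
   Context: Random walk on a growing graph (RWoGG). A RWoGG is a triple $\mathcal D=(\mathfrak d,G,P)$, where $\mathfrak d:\mathbb Z_{>0}\to\mathbb Z_{\ge0}$ (the duration), $G(n)=(V(n),E(n))$ is a finite simple undirected graph for each $n\ge1$ with $V(n)\subseteq V(n+1)$ and $E(n)\subseteq E(n+1)$, and $P(n)$ is a stochastic matrix on $V(n)$ (transition probabilities of a random walk on $G(n)$). Put $T_0=0$ and $T_n=\sum_{i=1}^n\mathfrak d(i)$; it is assumed that $T_n\to\infty$, so that the walk is defined at all times. The walk $X_0,X_1,X_2,\dots$ started at $v\in V(1)$ is the Markov process with $X_0=v$ in which the transition from $X_t$ to $X_{t+1}$ follows $P(n)$ whenever $T_{n-1}\le t<T_n$. Let $R(t)=\Pr[X_t=v]$. The vertex $v$ is recurrent by $\mathcal D$ if $\sum_{t=1}^\infty R(t)=\infty$, and transient by $\mathcal D$ otherwise. Complete $k$-ary tree of height $n$: a rooted tree in which every internal node (including the root) has exactly $k$ children and every leaf is at distance $n$ from the root. The trees are nested, $V_n\subseteq V_{n+1}$, $E_n\subseteq E_{n+1}$, with common root $r$ ($G_{n+1}$ is obtained from $G_n$ by attaching $k$ children to each leaf). *)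

(* Defs.v *)
From HB Require Import structures.
From mathcomp Require Import all_boot all_order all_algebra finmap.
From mathcomp Require Import all_classical all_reals all_analysis.

Set Implicit Arguments.
Unset Strict Implicit.
Unset Printing Implicit Defensive.

Import Order.TTheory GRing.Theory Num.Theory.

Local Open Scope fset_scope.
Local Open Scope ring_scope.

Record fin_graph (V : choiceType) := FinGraph {
  vertices : {fset V};
  edge : rel V;
  edge_sym : symmetric edge;
  edge_irr : irreflexive edge;
  edge_vertices : forall u v, edge u v -> (u \in vertices) && (v \in vertices)
}.

(** A stochastic matrix on the finite set [A], extended by zero outside
    [A] x [A]. *)
Definition stochastic_on (R : realType) (V : choiceType) (A : {fset V})
    (M : V -> V -> R) : Prop :=
  [/\ forall u v, 0 <= M u v,
      forall u v, M u v != 0 -> (u \in A) && (v \in A)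
    & forall u, u \in A -> \sum_(v <- A) M u v = 1].

(** The time usually written T_n. *)
Definition phase_end (dur : nat -> nat) (n : nat) : nat :=
  (\sum_(1 <= i < n.+1) dur i)%N.

(** All sequences are indexed by the positive integers: the values of
    [duration], [graph] and [trans] at [0] are never used.  A walker moves along
    an edge or stays put. *)
Record rwogg (R : realType) (V : choiceType) := RWoGG {
  duration : nat -> nat;
  graph : nat -> fin_graph V;
  trans : nat -> V -> V -> R;
  vertices_mono : forall n, (0 < n)%N ->
    vertices (graph n) `<=` vertices (graph n.+1);
  edge_mono : forall n, (0 < n)%N ->
    subrel (edge (graph n)) (edge (graph n.+1));
  trans_stochastic : forall n, (0 < n)%N ->
    stochastic_on (vertices (graph n)) (trans n);
  trans_walk : forall n u v, (0 < n)%N -> trans n u v != 0 ->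
    (u == v) || edge (graph n) u v;
  duration_infinite : (phase_end duration n @[n --> \oo] --> \oo)%classic
}.

Section Walk.
Context (R : realType) (V : choiceType) (d : measure_display)
  (Omega : measurableType d) (Pr : probability Omega R).

Definition history (X : nat -> Omega -> V) (x : nat -> V) (t : nat)
    : set Omega :=
  [set w | forall s, (s <= t)%N -> X s w = x s]%classic.

(** [X] is the walk of [D] started at [v].  The last clause is the Markov
    property together with the prescribed transition probabilities, multiplied
    out so that no conditioning on null events occurs. *)
Definition is_walk (D : rwogg R V) (v : V) (X : nat -> Omega -> V) : Prop :=
  [/\ v \in vertices (graph D 1),
      forall t u, measurable [set w | X t w = u]%classic,
      Pr [set w | X 0%N w = v]%classic = 1%E
    & forall n t x, (0 < n)%N ->
        (phase_end (duration D) n.-1 <= t < phase_end (duration D) n)%N ->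
        Pr (history X x t.+1) =
          (Pr (history X x t) * (trans D n (x t) (x t.+1))%:E)%E].

Definition return_prob (X : nat -> Omega -> V) (v : V) (t : nat) : \bar R :=
  Pr [set w | X t w = v]%classic.

Definition recurrent (X : nat -> Omega -> V) (v : V) : Prop :=
  (\sum_(1 <= t <oo) return_prob X v t = +oo)%E.

Definition transient (X : nat -> Omega -> V) (v : V) : Prop :=
  ~ recurrent X v.

End Walk.

(** A vertex is its address, read from the vertex up to the root: the children
    of [u] are the [i :: u] for [i : 'I_k], and the root is [[::]]. *)
Section Tree.
Context (k : nat).
Implicit Types u v : seq 'I_k.

Definition tree_root : seq 'I_k := [::].

Definition is_child u v : bool := [exists i : 'I_k, v == i :: u].

Definition tree_level (m : nat) : {fset seq 'I_k} :=
  [fset val t | t in {: m.-tuple 'I_k}].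

Definition tree_vertices (n : nat) : {fset seq 'I_k} :=
  \bigcup_(m <- iota 0 n.+1) tree_level m.

Lemma in_tree_level m u : (u \in tree_level m) = (size u == m).
Proof.
apply/imfsetP/eqP => [[t _ ->]|sz_u]; first exact: size_tuple.
by exists (tcast sz_u (in_tuple u)); rewrite ?inE //= val_tcast.
Qed.

Lemma in_tree_vertices n u : (u \in tree_vertices n) = (size u <= n)%N.
Proof.
apply/bigfcupP/idP => [[m]|le_un].
  by rewrite mem_iota add0n ltnS in_tree_level andbT => le_mn /eqP ->.
by exists (size u); rewrite ?in_tree_level // mem_iota add0n ltnS le_un.
Qed.

Lemma is_childP u v : reflect (exists i, v = i :: u) (is_child u v).
Proof. exact: 'exists_eqP. Qed.

Definition tree_edge (n : nat) : rel (seq 'I_k) := fun u v =>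
  [&& u \in tree_vertices n, v \in tree_vertices n
    & is_child u v || is_child v u].

Lemma tree_edge_sym n : symmetric (tree_edge n).
Proof. by move=> u v; rewrite /tree_edge andbCA orbC. Qed.

Lemma is_childxx u : is_child u u = false.
Proof. by apply/is_childP => -[i /(congr1 size)/eqP]; rewrite ltn_eqF. Qed.

Lemma tree_edge_irr n : irreflexive (tree_edge n).
Proof. by move=> u; rewrite /tree_edge is_childxx !andbF. Qed.

Lemma tree_edge_vertices n u v : tree_edge n u v ->
  (u \in tree_vertices n) && (v \in tree_vertices n).
Proof. by case/and3P => -> ->. Qed.

Definition kary_tree (n : nat) : fin_graph (seq 'I_k) :=
  FinGraph (@tree_edge_sym n) (@tree_edge_irr n) (@tree_edge_vertices n).

(** The distance from [u] to the root is [size u]. *)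
Definition is_leaf (n : nat) u : bool :=
  (u \in tree_vertices n) && (size u == n).

Definition is_internal (n : nat) u : bool :=
  (u \in tree_vertices n) && (size u != n).

Section Transitions.
Context (R : realType) (lambda : R).

Definition tree_trans (n : nat) u v : R :=
  if ~~ ((u \in tree_vertices n) && (v \in tree_vertices n)) then 0
  else if (u == tree_root) && is_child u v then 1 / k%:R
  else if (u != tree_root) && is_child u v then 1 / (lambda + k%:R)
  else if [&& is_internal n u, u != tree_root & is_child v u]
       then lambda / (lambda + k%:R)
  else if is_leaf n u && is_child v u then 1
  else 0.

Lemma tree_trans_edge n u v : tree_trans n u v != 0 -> tree_edge n u v.
Proof.
rewrite /tree_trans /tree_edge.
case: (u \in _) => //=; rewrite ?eqxx //; case: (v \in _) => //=; rewrite ?eqxx //.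
case: (is_child u v) => //=; rewrite ?andbF ?andbT.
by case: (is_child v u) => //; rewrite !andbF eqxx.
Qed.

Lemma sum_children n u (F : seq 'I_k -> R) : (size u < n)%N ->
  \sum_(v <- tree_vertices n | is_child u v) F v = \sum_(i < k) F (i :: u).
Proof.
move=> lt_un; rewrite -big_filter -(big_map (fun i => i :: u) xpredT F).
apply: perm_big; apply: uniq_perm.
- by rewrite filter_uniq // fset_uniq.
- by rewrite map_inj_uniq ?index_enum_uniq // => i j [].
move=> v; rewrite mem_filter; apply/andP/mapP => [[/is_childP[i ->] _]|[i _ ->]].
  by exists i; rewrite ?mem_index_enum.
by split; [apply/is_childP; exists i|rewrite in_tree_vertices].
Qed.

Lemma sum_parent n i u (F : seq 'I_k -> R) : (size u <= n)%N ->
  \sum_(v <- tree_vertices n | is_child v (i :: u)) F v = F u.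
Proof.
move=> le_un; rewrite (eq_bigl (pred1 u)) => [|v].
  rewrite big_mkcond (bigD1_seq u) ?fset_uniq ?in_tree_vertices //=.
  by rewrite eqxx big1 ?addr0 // => v /negPf ->.
apply/is_childP/eqP => [[j [_ ->]] //|->]; by exists i.
Qed.

Hypotheses (k_ge2 : (2 <= k)%N) (lambda_gt0 : 0 < lambda).

Lemma tree_trans_stochastic n : (0 < n)%N ->
  stochastic_on (tree_vertices n) (tree_trans n).
Proof.
move=> n_gt0; have k_gt0 : 0 < k%:R :> R by rewrite ltr0n ltnW.
have lk_gt0 : 0 < lambda + k%:R by rewrite addr_gt0.
split=> [u v|u v /tree_trans_edge/tree_edge_vertices //|u].
  rewrite /tree_trans.
  by do ?case: ifP => _; rewrite ?ler01 // divr_ge0 ?ler01 // ltW.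
move=> uV; have le_un := uV; rewrite in_tree_vertices in le_un.
have sum_nchild (c : R) : size u = n ->
    \sum_(v <- tree_vertices n | is_child u v) c = 0.
  move=> szu; rewrite big_seq_cond big1 // => v /andP[+ /is_childP[i vE]].
  by rewrite in_tree_vertices vE /= szu ltnn.
have sum_child (c : R) : (size u < n)%N ->
    \sum_(v <- tree_vertices n | is_child u v) c = k%:R * c.
  by move=> lt_un; rewrite sum_children // sumr_const card_ord mulr_natl.
case: u uV le_un sum_nchild sum_child => [|i u] uV le_un sum_nchild sum_child.
  rewrite big_seq (eq_bigr (fun v => if is_child [::] v then 1 / k%:R else 0)).
    by rewrite -big_seq -big_mkcond sum_child // mulrCA divff ?mulr1 ?gt_eqF.
  move=> v vV; rewrite /tree_trans uV vV /= andbF.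
  have -> : is_child v [::] = false by apply/is_childP => -[].
  by rewrite andbF.
pose a : R := if size (i :: u) == n then 0 else 1 / (lambda + k%:R).
pose b : R := if size (i :: u) == n then 1 else lambda / (lambda + k%:R).
rewrite big_seq (eq_bigr (fun v => (if is_child (i :: u) v then a else 0) +
                                   (if is_child v (i :: u) then b else 0))).
  rewrite -big_seq big_split /=.
  rewrite -(big_mkcond (is_child (i :: u))) -(big_mkcond (is_child^~ (i :: u))).
  rewrite (sum_parent i (fun=> b) (ltnW le_un)).
  rewrite /a /b; case: eqVneq => [szu|szu].
    by rewrite sum_nchild // add0r.
  rewrite sum_child; last by rewrite ltn_neqAle szu.
  by rewrite mulrA mulr1 -mulrDl addrC divff ?gt_eqF.
move=> v vV; rewrite /tree_trans uV vV /= /is_internal /is_leaf uV /= /a /b.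
case: (is_childP (i :: u) v) => [[j vE]|_].
  have -> : is_child v (i :: u) = false.
    apply/is_childP => -[l]; rewrite vE => /(congr1 size) /= /eqP.
    by rewrite ltn_eqF.
  rewrite addr0; case: eqP => // szu.
  by move: vV; rewrite in_tree_vertices vE -szu /= ltnn.
by rewrite add0r; case: (is_child v _); case: (_ == n).
Qed.

Lemma tree_trans_walk n u v : (0 < n)%N -> tree_trans n u v != 0 ->
  (u == v) || edge (kary_tree n) u v.
Proof. by move=> _ /tree_trans_edge uv; apply/orP; right. Qed.

Lemma kary_tree_vertices_mono n : (0 < n)%N ->
  vertices (kary_tree n) `<=` vertices (kary_tree n.+1).
Proof.
move=> _; apply/fsubsetP => u /=; rewrite !in_tree_vertices; exact: leqW.
Qed.

Lemma kary_tree_edge_mono n : (0 < n)%N ->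
  subrel (edge (kary_tree n)) (edge (kary_tree n.+1)).
Proof.
move=> n_gt0 u v /= /and3P[/(fsubsetP (kary_tree_vertices_mono n_gt0)) uV].
move=> /(fsubsetP (kary_tree_vertices_mono n_gt0)) vV uv.
by apply/and3P; split.
Qed.

Definition tree_rwogg (dur : nat -> nat)
    (dur_infinite : (phase_end dur n @[n --> \oo] --> \oo)%classic)
    : rwogg R (seq 'I_k) :=
  @RWoGG R (seq 'I_k) dur kary_tree tree_trans kary_tree_vertices_mono
    kary_tree_edge_mono tree_trans_stochastic tree_trans_walk dur_infinite.

End Transitions.
End Tree.

(* Main.v *)
Require Import Defs.
From mathcomp Require Import all_boot all_order all_algebra finmap.
From mathcomp Require Import all_classical all_reals all_analysis.
From mathcomp Require Import ring lra.

Set Implicit Arguments.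
Unset Strict Implicit.
Unset Printing Implicit Defensive.

Import Order.TTheory GRing.Theory Num.Theory.

Local Open Scope ring_scope.

(** Only the level of the walk matters, and on levels the walk is a
    birth-and-death chain: away from the root and the leaves it goes up with
    probability p = k / (lambda + k) and down with q = lambda / (lambda + k),
    so that q / p is the ratio rho = lambda / k of the series. The expected
    numbers of visits to the root are estimated by potentials: if one step of
    the walk changes the expectation of a function by a known amount, summing
    over time bounds the accumulated changes ([expect_drift]). A potential may
    depend on the height of the tree as long as it decreases when the tree
    grows.

    Let n(t) be the height of the tree at time t. The sum of rho ^ n(t) over all
    times t is the series of the theorem ([sum_phase]).

    If rho < 1, the function rho ^ x / (1 - rho) of the level x is harmonic away
    from the root and the leaves, loses 1 at the root and gains rho ^ (n - 1) at
    the leaves of the tree of height n. Hence, up to bounded terms, the expected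
    number of visits to the root is the sum of rho ^ (n(t) - 1) times the
    probability to be at a leaf at time t. This is at most the series divided by
    rho ([visits_ub]). Conversely, inside the tree the level drifts towards the
    leaves at speed p - q > 0 and only the leaves reflect it, so that the walk
    spends a positive fraction of its time there. The level weighted by rho ^ n
    makes this precise and gives a lower bound by a multiple of the series
    ([visits_lb]).

    If rho >= 1, the series diverges since its partial sums are at least those
    of the durations, and the walk is always recurrent: only the root pushes the
    level up, so if the expected number of visits were finite the expected level
    would stay bounded, and a concave potential shows that a walk which stays in
    a bounded range visits the root again and again ([visits_unbounded]). *)

(** * Series and phases *)

Lemma nneseries_pinfty (R : realType) (a : nat -> R) :
  (forall n, 0 <= a n) ->
  (\sum_(1 <= n <oo) (a n)%:E = +oo)%E <->
  forall B, exists N, B <= \sum_(1 <= n < N) a n.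
Proof.
move=> a_ge0; split=> [sum_oo B | unbounded].
  apply: contrapT => bounded.
  suff: (\sum_(1 <= n <oo) (a n)%:E <= B%:E)%E by rewrite sum_oo.
  apply: lime_le; first by apply: is_cvg_nneseries => n _ _; rewrite lee_fin.
  apply: nearW => N; rewrite sumEFin lee_fin leNgt; apply/negP => /ltW le_BN.
  by apply: bounded; exists N.
apply/eqyP => B _; have [N le_BN] := unbounded B.
apply: le_trans (nneseries_lim_ge N _) => [|n _ _]; last by rewrite lee_fin.
by rewrite sumEFin lee_fin.
Qed.

Section Phase.
Context (dur : nat -> nat).
Hypothesis dur_infinite : (phase_end dur n @[n --> \oo] --> \oo)%classic.

Local Notation T_ := (phase_end dur).

Lemma phase_endS n : T_ n.+1 = (T_ n + dur n.+1)%N.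
Proof. by rewrite /phase_end big_nat_recr. Qed.

Lemma phase_end_homo : {homo T_ : m n / (m <= n)%N}.
Proof.
apply: homo_leq => [//|m n p|n]; first exact: leq_trans.
by rewrite phase_endS leq_addr.
Qed.

Lemma phase_exists t : exists n, (t < T_ n)%N.
Proof.
move/cvgnyPgt: dur_infinite => /(_ t)[n _ lt_t].
by exists n; exact: lt_t (leqnn n).
Qed.

(** Phases of duration zero are skipped: the phase of [t] is the only positive
    [n] with [T_ n.-1 <= t < T_ n]. *)
Definition phase t : nat := ex_minn (phase_exists t).

Lemma phase_gt0 t : (0 < phase t)%N.
Proof.
rewrite /phase; case: ex_minnP => -[|//].
by rewrite /phase_end big_geq.
Qed.

Lemma phase_bounds t : (T_ (phase t).-1 <= t < T_ (phase t))%N.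
Proof.
have := phase_gt0 t; rewrite /phase; case: ex_minnP => -[//|n] lt_t min_n _.
rewrite lt_t andbT leqNgt; apply/negP => /min_n; by rewrite ltnn.
Qed.

Lemma phase_mono t : (phase t <= phase t.+1)%N.
Proof.
rewrite {1}/phase; case: ex_minnP => n _; apply.
by have /andP[_] := phase_bounds t.+1; exact: leq_trans.
Qed.

Lemma phase_eq n t : (T_ n <= t < T_ n.+1)%N -> phase t = n.+1.
Proof.
case/andP=> le_nt lt_tn; rewrite /phase; case: ex_minnP => m lt_tm min_m.
apply/eqP; rewrite eqn_leq min_m //= ltnNge; apply/negP => /phase_end_homo.
by rewrite leqNgt (leq_ltn_trans le_nt lt_tm).
Qed.

Lemma sum_phase (R : pzRingType) (c : nat -> R) N :
  \sum_(0 <= t < T_ N) c (phase t) = \sum_(1 <= n < N.+1) (dur n)%:R * c n.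
Proof.
elim: N => [|N IHN]; first by rewrite /phase_end !big_geq.
rewrite big_nat_recr //= -IHN phase_endS (big_cat_nat (n := T_ N)) ?leq_addr //=.
congr (_ + _); rewrite big_nat_cond (eq_bigr (fun=> c N.+1)) => [|t].
  by rewrite -big_nat_cond sumr_const_nat addKn mulr_natl.
by rewrite andbT -phase_endS => /phase_eq ->.
Qed.

Lemma phase_end_unbounded N : exists n, (N <= T_ n)%N.
Proof. by have [n /ltnW] := phase_exists N; exists n. Qed.

End Phase.

(** * Distribution of a walk on a growing graph *)

Section Distribution.
Context (R : realType) (d : measure_display) (Omega : measurableType d)
  (Pr : probability Omega R).
Implicit Types (A B : set Omega).

Local Open Scope classical_set_scope.

Definition prob A : R := fine (Pr A).

Lemma probE A : measurable A -> Pr A = (prob A)%:E.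
Proof. by move=> mA; rewrite fineK ?fin_num_measure. Qed.

Lemma prob_ge0 A : 0 <= prob A.
Proof. by rewrite fine_ge0. Qed.

(** The part of [B] where [Y] is outside [S] is null, because [S] carries the
    whole mass of [Y]. *)
Lemma total_probability (V : choiceType) (Y : Omega -> V) (S : {fset V}) B :
    (forall u, measurable [set w | Y w = u]) ->
    \sum_(u <- S) prob [set w | Y w = u] = 1 -> measurable B ->
  prob B = \sum_(u <- S) prob (B `&` [set w | Y w = u]).
Proof.
move=> mY sum1 mB.
set C := \big[setU/set0]_(u <- S) [set w | Y w = u].
have mC : measurable C by apply: bigsetU_measurable.
have trivY : trivIset [set` S] (fun u => [set w | Y w = u]).
  by move=> u v _ _ [w /= [<- <-]].
have PC1 : Pr C = 1%E.
  rewrite (measure_fbigsetU Pr) // -EFin_sum_fine ?sum1 // => u _.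
  exact: fin_num_measure.
have PBC : Pr B = Pr (B `&` C).
  rewrite (measureDI Pr mB mC) [X in (X + _)%E](_ : _ = 0%E) ?add0e //.
  apply/eqP; rewrite -measure_le0 -(subee (x := 1%E)) // -[X in (_ - X)%E]PC1.
  rewrite -probability_setC //; apply: le_measure; rewrite ?inE.
  - exact: measurableD.
  - exact: measurableC.
  - by move=> w [].
rewrite /prob PBC sum_fine => [|u _]; last first.
  by apply: fin_num_measure; apply: measurableI.
congr fine; rewrite -measure_fbigsetU => [|u _|].
- by congr (Pr _); rewrite /C; elim/big_rec2: _ => [|u A1 A2 _ <-];
    rewrite ?setI0 // setIUr.
- exact: measurableI.
- by move=> u v _ _ [w /= [[_ <-] [_ <-]]].
Qed.

End Distribution.

Section Law.
Context (R : realType) (V : choiceType) (d : measure_display)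
  (Omega : measurableType d) (Pr : probability Omega R).
Context (D : rwogg R V) (v0 : V) (X : nat -> Omega -> V).
Hypothesis hX : is_walk Pr D v0 X.

Local Open Scope classical_set_scope.

Local Notation ph := (phase (duration_infinite D)).
Local Notation S_ t := (vertices (graph D (ph t))).
Local Notation P_ t := (trans D (ph t)).

Definition law t u : R := prob Pr [set w | X t w = u].

Let measurable_pt t u : measurable [set w | X t w = u].
Proof. by case: hX. Qed.

(** Interpolates between the histories, with [j = 0], for which the Markov
    property is given, and the transitions of a single step, with [j = t]. *)
Definition window (x : nat -> V) j t : set Omega :=
  [set w | forall s, (j <= s <= t)%N -> X s w = x s].

Lemma measurable_window x j t : measurable (window x j t).
Proof.
rewrite (_ : window x j t =
  \bigcap_(s in [set s | (j <= s <= t)%N]) [set w | X s w = x s]).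
  by apply: bigcap_measurableType.
by apply/seteqP; split=> w.
Qed.

(** The state at time [j] is forgotten by summing over its values; this uses
    that the law at time [j] is carried by the finite vertex set of that time,
    which is therefore assumed here and established by induction in
    [law_mass]. *)
Lemma window_markov x j t :
    (forall i, (i < j)%N -> \sum_(u <- S_ i) law i u = 1) -> (j <= t)%N ->
  prob Pr (window x j t.+1) = prob Pr (window x j t) * P_ t (x t) (x t.+1).
Proof.
elim: j x => [|j IHj] x mass1 le_jt.
  case: hX => _ _ _ /(_ (ph t) t x (phase_gt0 _ t) (phase_bounds _ t)).
  have histE s : history X x s = window x 0 s.
    by apply/seteqP; split=> w; exact.
  by rewrite !histE !(probE _ (measurable_window _ _ _)) => -[].
pose y u s := if s == j then u else x s.
have winI u t' : (j < t')%N ->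
    window x j.+1 t' `&` [set w | X j w = u] = window (y u) j t'.
  move=> lt_jt; apply/seteqP; split=> w /=.
    move=> [xw Xj] s /andP[le_js le_st]; rewrite /y; case: eqVneq => [->//|ne_sj].
    by apply: xw; rewrite le_st ltn_neqAle eq_sym ne_sj le_js.
  move=> yw; split=> [s /andP[lt_js le_st]|].
    by rewrite yw ?le_st ?(ltnW lt_js) // /y gtn_eqF.
  by rewrite yw ?leqnn ?(ltnW lt_jt) // /y eqxx.
have massj := mass1 j (ltnSn j).
have splitE t' := total_probability (measurable_pt j) massj
  (measurable_window x j.+1 t').
rewrite !splitE.
rewrite mulr_suml; apply: eq_bigr => u _; rewrite !winI ?(leqW le_jt) //.
rewrite IHj ?(ltnW le_jt) // => [|i lt_ij]; last exact/mass1/leqW.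
by rewrite /y !gtn_eqF // ltnW.
Qed.

Lemma law_step t v : (forall i, (i <= t)%N -> \sum_(u <- S_ i) law i u = 1) ->
  law t.+1 v = \sum_(u <- S_ t) law t u * P_ t u v.
Proof.
move=> mass1; rewrite {1}/law (total_probability _ (mass1 t _)) //.
apply: eq_bigr => u _; pose x s := if s == t then u else v.
have win1 : window x t t = [set w | X t w = u].
  apply/seteqP; split=> w /= => [/(_ t)|Xt s].
    by rewrite leqnn /x eqxx; apply.
  by rewrite -eqn_leq => /eqP <-; rewrite /x eqxx.
have win2 : window x t t.+1 = [set w | X t.+1 w = v] `&` [set w | X t w = u].
  apply/seteqP; split=> w /=.
    move=> xw; split; [have := xw t.+1 | have := xw t]; rewrite /x.
      by rewrite leqnn leqnSn gtn_eqF //; apply.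
    by rewrite leqnn leqnSn eqxx //; apply.
  move=> [Xt1 Xt] s; rewrite leq_eqVlt /x eq_sym; case: eqVneq => [-> //|_ /=].
  by rewrite -eqn_leq => /eqP <-.
have := window_markov x (t := t) (fun i lt_it => mass1 i (ltnW lt_it)) (leqnn t).
by rewrite win1 win2 => ->; rewrite /x eqxx gtn_eqF.
Qed.

Lemma vertices_homo m n : (0 < m <= n)%N ->
  (vertices (graph D m) `<=` vertices (graph D n))%fset.
Proof.
case/andP=> m_gt0; elim: n => [|n IHn]; first by case: m m_gt0.
rewrite leq_eqVlt => /predU1P[->|/[!ltnS] le_mn]; first exact: fsubset_refl.
apply: fsubset_trans (IHn le_mn) _; apply: vertices_mono.
exact: leq_trans le_mn.
Qed.

Lemma law_start u : law 0 u = (u == v0)%:R.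
Proof.
case: hX => _ _ X0 _; rewrite /law /prob.
have [->|ne_uv] := eqVneq u v0; first by rewrite X0.
have: (Pr [set w | X 0 w = u] <= Pr (~` [set w | X 0 w = v0]))%E.
  apply: le_measure; rewrite ?inE //; first exact: measurableC.
  by move=> w /= -> /eqP; rewrite (negPf ne_uv).
rewrite probability_setC // X0 subee // measure_le0 => /eqP -> //.
Qed.

Lemma start_in_vertices t : v0 \in S_ t.
Proof.
case: hX => v0V _ _ _; apply: (fsubsetP (@vertices_homo 1 _ _)) v0V.
by rewrite phase_gt0.
Qed.

(** At time [t + 1] the walk is still in the graph of time [t], so that the law
    may be summed over the vertices of either graph. *)
Lemma law_step_out t v :
    (forall i, (i <= t)%N -> \sum_(u <- S_ i) law i u = 1) ->
  v \notin S_ t -> law t.+1 v = 0.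
Proof.
move=> mass1 vnS; rewrite law_step // big1 // => u _.
have [_ suppP _] := @trans_stochastic _ _ D _ (phase_gt0 (duration_infinite D) t).
have [->|/(suppP u v)/andP[_]] := eqVneq (P_ t u v) 0; first by rewrite mulr0.
by rewrite (negPf vnS).
Qed.

Lemma law_step_sum t
    (mass1 : forall i, (i <= t)%N -> \sum_(u <- S_ i) law i u = 1)
    (F : V -> R) :
  \sum_(v <- S_ t.+1) law t.+1 v * F v =
  \sum_(u <- S_ t) law t u * \sum_(v <- S_ t) P_ t u v * F v.
Proof.
rewrite -(@big_fset_incl _ _ _ _ (S_ t)); first last.
- by move=> v _ vnS; rewrite law_step_out ?mul0r.
- by apply: vertices_homo; rewrite phase_gt0 phase_mono.
under eq_bigr do rewrite law_step // mulr_suml.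
rewrite exchange_big /=; apply: eq_bigr => u _.
by rewrite mulr_sumr; apply: eq_bigr => v _; rewrite mulrA.
Qed.

Lemma law_mass t : \sum_(u <- S_ t) law t u = 1.
Proof.
elim/ltn_ind: t => -[_|t IHt].
  rewrite (bigD1_seq v0) ?fset_uniq ?start_in_vertices //= law_start eqxx.
  by rewrite big1 ?addr0 // => u /negPf ne_uv; rewrite law_start ne_uv.
under eq_bigr do rewrite -[law _ _]mulr1.
rewrite (law_step_sum IHt (fun=> 1)) -[RHS](IHt t (ltnSn t)).
rewrite !big_seq; apply: eq_bigr => u uS.
have [_ _ /(_ u uS) row_sum] :=
  @trans_stochastic _ _ D _ (phase_gt0 (duration_infinite D) t).
 rewrite (eq_bigr (P_ t u)) => [|v _]; last by rewrite mulr1.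
by rewrite row_sum mulr1.
Qed.

Definition expect t (F : V -> R) : R := \sum_(u <- S_ t) law t u * F u.

Lemma le_expect t F G : (forall u, u \in S_ t -> F u <= G u) ->
  expect t F <= expect t G.
Proof.
move=> leFG; rewrite /expect !big_seq; apply: ler_sum => u uS.
by rewrite ler_wpM2l ?leFG // prob_ge0.
Qed.

Lemma expectD t F G : expect t (fun u => F u + G u) = expect t F + expect t G.
Proof. by rewrite -big_split; apply: eq_bigr => u _; rewrite mulrDr. Qed.

Lemma expectZ t c F : expect t (fun u => c * F u) = c * expect t F.
Proof. by rewrite /expect mulr_sumr; apply: eq_bigr => u _; rewrite mulrCA. Qed.

Lemma expect_cst t c : expect t (fun=> c) = c.
Proof. by rewrite /expect -mulr_suml law_mass mul1r. Qed.

Lemma expect_indic t v : v \in S_ t -> expect t (fun u => (u == v)%:R) = law t v.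
Proof.
move=> vS; rewrite /expect (bigD1_seq v) ?fset_uniq //= eqxx mulr1.
by rewrite big1 ?addr0 // => u /negPf ->; rewrite mulr0.
Qed.

Lemma expect_start F : expect 0 F = F v0.
Proof.
rewrite /expect (bigD1_seq v0) ?fset_uniq ?start_in_vertices //= law_start eqxx.
rewrite mul1r big1 ?addr0 // => u /negPf ne_uv.
by rewrite law_start ne_uv mul0r.
Qed.

(** When the graph grows the potential is replaced by that of the larger graph,
    which the second hypothesis bounds at the vertices already present; several
    graphs may be skipped at once, because durations can be zero. *)
Lemma expect_drift (Phi b : nat -> V -> R) :
    (forall n u, (0 < n)%N -> u \in vertices (graph D n) ->
       \sum_(v <- vertices (graph D n)) trans D n u v * Phi n v
         <= Phi n u + b n u) ->
    (forall n u, (0 < n)%N -> u \in vertices (graph D n) ->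
       Phi n.+1 u <= Phi n u) ->
  forall T, expect T (Phi (ph T)) <=
    Phi (ph 0) v0 + \sum_(0 <= t < T) expect t (b (ph t)).
Proof.
move=> drift anti; elim=> [|T IHT].
  by rewrite big_geq // addr0 expect_start.
have Phi_anti m n u : (0 < m <= n)%N -> u \in vertices (graph D m) ->
    Phi n u <= Phi m u.
  move=> /andP[m_gt0]; elim: n => [|n IHn]; first by case: m m_gt0.
  rewrite leq_eqVlt => /predU1P[->//|/[!ltnS] le_mn] uV.
  apply: le_trans (IHn le_mn uV); apply: anti; first exact: leq_trans le_mn.
  by apply: (fsubsetP (vertices_homo _)) uV; rewrite m_gt0.
rewrite big_nat_recr //= addrA.
apply: le_trans (lerD IHT (lexx _)); rewrite -expectD.
have stepE F := law_step_sum (fun i (_ : (i <= T)%N) => law_mass i) F.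
apply: (@le_trans _ _ (expect T.+1 (Phi (ph T)))); last first.
  rewrite {1}/expect stepE; apply: le_expect => u uS.
  exact: drift (phase_gt0 _ _) uS.
have sub : (S_ T `<=` S_ T.+1)%fset.
  by apply: vertices_homo; rewrite phase_gt0 phase_mono.
have out v : v \notin S_ T -> law T.+1 v = 0.
  by apply: law_step_out => i _; exact: law_mass.
rewrite /expect; apply: ler_sum => u _.
have [uS|/out ->] := boolP (u \in S_ T); last by rewrite !mul0r.
by rewrite ler_wpM2l ?prob_ge0 // Phi_anti // phase_gt0 phase_mono.
Qed.

End Law.

(** * The level of the walk on the growing tree *)

Section TreeWalk.
Context (R : realType) (k : nat) (lambda : R).
Hypotheses (hk : (2 <= k)%N) (hlambda : 0 < lambda).

Let p : R := k%:R / (lambda + k%:R).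
Let q : R := lambda / (lambda + k%:R).
Let rho : R := lambda / k%:R.

Let k_gt0 : 0 < k%:R :> R. Proof. by rewrite ltr0n ltnW. Qed.
Let lk_gt0 : 0 < lambda + k%:R. Proof. exact: addr_gt0. Qed.
Let p_gt0 : 0 < p. Proof. exact: divr_gt0. Qed.
Let q_gt0 : 0 < q. Proof. exact: divr_gt0. Qed.
Let rho_gt0 : 0 < rho. Proof. exact: divr_gt0. Qed.
Let pDq : p + q = 1. Proof. by rewrite -mulrDl addrC divff // gt_eqF. Qed.
Let rhopE : rho * p = q. Proof. by rewrite /rho /p mulrA divfK // gt_eqF. Qed.

Let harmonic x : p * rho ^+ x.+2 + q * rho ^+ x = rho ^+ x.+1.
Proof.
by rewrite -[RHS]mul1r -pDq mulrDl !exprS -rhopE; ring.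
Qed.

Definition level_step (n : nat) (f : nat -> R) (x : nat) : R :=
  if x == 0%N then f 1%N else if x == n then f x.-1 else p * f x.+1 + q * f x.-1.

Lemma tree_trans_level n u (f : nat -> R) :
    (0 < n)%N -> u \in tree_vertices k n ->
  \sum_(v <- tree_vertices k n) tree_trans lambda n u v * f (size v)
    = level_step n f (size u).
Proof.
move=> n_gt0 uV; have le_un := uV; rewrite in_tree_vertices in le_un.
rewrite /level_step; case: u uV le_un => [|i u] uV le_un /=.
  rewrite big_seq.
  rewrite (eq_bigr (fun v => if is_child [::] v then f 1%N / k%:R else 0)).
    rewrite -big_seq -big_mkcond sum_children // sumr_const card_ord.
    by rewrite -[LHS]mulr_natr divfK // gt_eqF.
  move=> v vV; rewrite /tree_trans uV vV /= andbF.
  have -> : is_child v [::] = false by apply/is_childP => -[].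
  rewrite andbF; case: is_childP => [[j ->]|_]; last by rewrite mul0r.
  by rewrite /= mulrC mul1r.
pose a : R := if size (i :: u) == n then 0 else 1 / (lambda + k%:R).
pose b : R := if size (i :: u) == n then 1 else q.
rewrite big_seq (eq_bigr (fun v =>
  (if is_child (i :: u) v then a * f (size u).+2 else 0) +
  (if is_child v (i :: u) then b * f (size u) else 0))).
  rewrite -big_seq big_split /= -(big_mkcond (@is_child k (i :: u))).
  rewrite -(big_mkcond (fun v => @is_child k v (i :: u))).
  rewrite (sum_parent i (fun=> b * f (size u)) (ltnW le_un)).
  rewrite /a /b /=; case: eqVneq => [szu|szu].
    by rewrite big1 ?add0r ?mul1r // => v _; rewrite mul0r.
  rewrite sum_children; last by rewrite ltn_neqAle szu.
  by rewrite sumr_const card_ord -[X in X + _]mulr_natl !mulrA mulr1.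
move=> v vV; rewrite /tree_trans uV vV /= /is_internal /is_leaf uV /= /a /b.
case: (is_childP (i :: u) v) => [[j vE]|_].
  have -> : is_child v (i :: u) = false.
    apply/is_childP => -[l]; rewrite vE => /(congr1 size) /= /eqP.
    by rewrite ltn_eqF.
  rewrite addr0 vE /=; case: eqP => // szu.
  by move: vV; rewrite in_tree_vertices vE -szu /= ltnn.
rewrite add0r; case: is_childP => [[j [_ ->]]|_].
  by case: (_ == n).
by rewrite !andbF mul0r.
Qed.

Context (dur : nat -> nat).
Hypothesis hdur : (phase_end dur n @[n --> \oo] --> \oo)%classic.
Context (d : measure_display) (Omega : measurableType d)
  (Pr : probability Omega R) (X : nat -> Omega -> seq 'I_k).

Local Notation D := (tree_rwogg hk hlambda hdur).
Local Notation root := (tree_root k).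

Hypothesis hX : is_walk Pr D root X.

Local Notation ph := (phase hdur).
Local Notation expect := (expect Pr D X).

Definition visits T : R := \sum_(0 <= t < T) law Pr X t root.

Lemma level_drift (phi b : nat -> nat -> R) T :
    (forall n x, (0 < n)%N -> (x <= n)%N ->
       level_step n (phi n) x <= phi n x + b n x) ->
    (forall n x, (0 < n)%N -> (x <= n)%N -> phi n.+1 x <= phi n x) ->
  expect T (fun u => phi (ph T) (size u)) <=
    phi (ph 0) 0%N + \sum_(0 <= t < T) expect t (fun u => b (ph t) (size u)).
Proof.
move=> drift anti.
apply: (expect_drift hX (Phi := fun n u => phi n (size u))
  (b := fun n u => b n (size u))) => n u n_gt0 uV.
  rewrite tree_trans_level //; apply: drift => //.
  by rewrite in_tree_vertices in uV.
by apply: anti => //; rewrite in_tree_vertices in uV.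
Qed.

Lemma expect_visit t c w : expect t (fun u => c * (size u == 0%N)%:R + w) =
  c * law Pr X t root + w.
Proof.
rewrite expectD expectZ (expect_cst hX); congr (c * _ + w).
rewrite -(expect_indic Pr X (start_in_vertices hX t)).
by apply: eq_bigr => u _; rewrite size_eq0.
Qed.

(** Potential rho ^ x / (1 - rho): bounded, and its only gain is rho ^ (n - 1),
    at the leaves, which is bounded by charging it at every time. *)
Lemma visits_ub T : rho < 1 ->
  visits T <= (1 - rho)^-1 + rho^-1 * \sum_(0 <= t < T) rho ^+ ph t.
Proof.
move=> rho_lt1; have h_gt0 : 0 < 1 - rho by rewrite subr_gt0.
pose b n x : R := -1 * (x == 0%N)%:R + rho^-1 * rho ^+ n.
pose f x := rho ^+ x / (1 - rho).
have drift n x : (0 < n)%N -> (x <= n)%N -> level_step n f x <= f x + b n x.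
  move=> n_gt0 le_xn; rewrite /level_step /b /f; case: x le_xn => [|x] le_xn /=.
    rewrite expr1 expr0 mulr1 -subr_ge0.
    have -> : 1 / (1 - rho) + (-1 + rho^-1 * rho ^+ n) - rho / (1 - rho)
      = rho^-1 * rho ^+ n by field; rewrite !gt_eqF.
    by rewrite mulr_ge0 ?invr_ge0 ?exprn_ge0 // ltW.
  case: eqP => [<-|_].
    rewrite mulr0 add0r [leRHS](_ : _ = f x) // /f.
    by rewrite exprS; field; rewrite !gt_eqF.
  rewrite mulr0 add0r.
  have -> : p * (rho ^+ x.+2 / (1 - rho)) + q * (rho ^+ x / (1 - rho)) =
      rho ^+ x.+1 / (1 - rho).
    by rewrite (mulrA p) (mulrA q) -mulrDl harmonic.
  by rewrite lerDl mulr_ge0 ?invr_ge0 ?exprn_ge0 // ltW.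
have ge0 : 0 <= expect T (fun u => f (size u)).
  rewrite -[leLHS](expect_cst hX T); apply: le_expect => u _.
  by rewrite divr_ge0 ?exprn_ge0 // ltW.
have := le_trans ge0 (level_drift T drift (fun _ _ _ _ => lexx _)); rewrite /b.
under eq_bigr do rewrite expect_visit.
rewrite big_split /= -!mulr_sumr /f expr0 div1r -/(visits T); lra.
Qed.

(** The weighted height rho ^ n (n + C - x) decreases on average by at least
    (p - q) rho ^ n, except at the leaves, where it increases by rho ^ n. That is
    compensated by subtracting twice the function rho ^ (x + 1) / (1 - rho),
    which gains rho ^ n there at the cost of losing rho at the root. *)
Lemma visits_lb T : rho < 1 ->
  (p - q) * \sum_(0 <= t < T) rho ^+ ph t <=
    2 * rho * visits T + ((ph 0)%:R + rho / (1 - rho) + 2 * rho / (1 - rho)).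
Proof.
move=> rho_lt1; have h_gt0 : 0 < 1 - rho by rewrite subr_gt0.
(* The constant [C] is the least for which rho ^ n (n + C - x) decreases in n
   at all levels x <= n. *)
pose C := rho / (1 - rho); pose f x := rho ^+ x / (1 - rho).
have C_ge0 : 0 <= C by rewrite divr_ge0 // ltW.
pose phi n x : R := rho ^+ n * (n%:R + C - x%:R) - 2 * rho * f x.
pose b n x : R := 2 * rho * (x == 0%N)%:R + - ((p - q) * rho ^+ n).
have rn_ge0 n : 0 <= rho ^+ n by rewrite exprn_ge0 // ltW.
have rn_le1 n : rho ^+ n <= 1 by rewrite exprn_ile1 // ltW.
have rho2_ge0 : 0 <= 2 * rho by rewrite mulr_ge0 // ltW.
have drift n x : (0 < n)%N -> (x <= n)%N ->
    level_step n (phi n) x <= phi n x + b n x.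
  move=> n_gt0 le_xn; rewrite /level_step /b /phi /f.
  case: x le_xn => [|x] le_xn /=.
    rewrite expr1 expr0 mulr1.
    have -> : 2 * rho * (rho / (1 - rho)) = 2 * rho * (1 / (1 - rho)) - 2 * rho.
      by field; rewrite gt_eqF.
    have := rn_ge0 n; have := q_gt0; move: pDq; nra.
  case: eqP => [<-|_].
    rewrite mulr0 add0r.
    have -> : 2 * rho * (rho ^+ x.+1 / (1 - rho)) =
        2 * rho * (rho ^+ x / (1 - rho)) - 2 * rho ^+ x.+1.
      by rewrite exprS; field; rewrite gt_eqF.
    have := rn_ge0 x.+1; have := q_gt0; move: pDq; rewrite -[x.+1%:R]natr1; nra.
  have fE : p * (rho ^+ x.+2 / (1 - rho)) + q * (rho ^+ x / (1 - rho)) =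
      rho ^+ x.+1 / (1 - rho).
    by rewrite (mulrA p) (mulrA q) -mulrDl harmonic.
  rewrite -subr_ge0 (_ : _ - _ = 0) //; apply/eqP; rewrite subr_eq0; apply/eqP.
  rewrite -fE -[x.+2%:R]natr1 -[x.+1%:R]natr1.
  have -> : p = 1 - q by rewrite -pDq addrK.
  ring.
have anti n x : (0 < n)%N -> (x <= n)%N -> phi n.+1 x <= phi n x.
  move=> n_gt0 le_xn; rewrite /phi lerD2r exprS -[n.+1%:R]natr1 -subr_ge0.
  have -> : rho ^+ n * (n%:R + C - x%:R) - rho * rho ^+ n * (n%:R + 1 + C - x%:R)
     = rho ^+ n * ((1 - rho) * (n%:R - x%:R)).
    by rewrite /C; field; rewrite gt_eqF.
  by rewrite mulr_ge0 // mulr_ge0 ?subr_ge0 ?ler_nat // ltW.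
have lbE : - (2 * rho / (1 - rho)) <= expect T (fun u => phi (ph T) (size u)).
  rewrite -[leLHS](expect_cst hX T); apply: le_expect => u uV.
  rewrite /phi /f.
  have szu : (size u)%:R <= (ph T)%:R :> R.
    by rewrite ler_nat -in_tree_vertices.
  have : 0 <= rho ^+ ph T * ((ph T)%:R + C - (size u)%:R).
    by rewrite mulr_ge0 //; lra.
  have : 2 * rho * (rho ^+ size u / (1 - rho)) <= 2 * rho / (1 - rho).
    rewrite mulrA ler_wpM2r ?invr_ge0 ?(ltW h_gt0) //.
    by rewrite -[leRHS]mulr1 ler_wpM2l.
  lra.
have := le_trans lbE (level_drift T drift anti); rewrite /b.
under eq_bigr do rewrite expect_visit.
rewrite big_split /= sumrN -!mulr_sumr -/(visits T) /phi /f subr0.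
have : rho ^+ ph 0 * ((ph 0)%:R + C) <= (ph 0)%:R + C.
  by rewrite ler_piMl ?addr_ge0.
have : 0 <= 2 * rho * (rho ^+ 0 / (1 - rho)).
  by rewrite mulr_ge0 // divr_ge0 // ltW.
rewrite -/C; lra.
Qed.

Lemma expect_level_ub T : 1 <= rho -> expect T (fun u => (size u)%:R) <= visits T.
Proof.
move=> rho_ge1; have le_pq : p <= q by rewrite -rhopE ler_peMl // ltW.
pose b x : R := 1 * (x == 0%N)%:R + 0.
have drift n x : (0 < n)%N -> (x <= n)%N ->
    level_step n (fun x => x%:R) x <= x%:R + b x.
  case: x => [|x] n_gt0 le_xn; rewrite /level_step /b /=.
    by rewrite mulr1 addr0 add0r.
  rewrite mulr0 !addr0; case: eqP => _; first by rewrite ler_nat.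
  by rewrite -[x.+2%:R]natr1 -[x.+1%:R]natr1; have := pDq; nra.
have := level_drift T drift (fun _ _ _ _ => lexx _); rewrite /b.
by under eq_bigr do rewrite expect_visit mul1r addr0; rewrite add0r.
Qed.

(** Suppose that the number of visits is at most [B], hence also the expected
    level. A concave potential that is constant from level [M] on loses at least
    1 at each step spent strictly between the root and [M], and gains about [2M]
    at the root. By Markov's inequality, in the form 1 - x / M <= 1 for x < M and
    1 - x / M <= 0 otherwise, at least half of the time is spent below [M] when
    [M > 2B], so that the time is bounded, a contradiction. *)
Lemma visits_unbounded B : 1 <= rho -> exists T, B <= visits T.
Proof.
move=> rho_ge1; have le_pq : p <= q by rewrite -rhopE ler_peMl // ltW.
apply: contrapT => bounded.
have visits_lt T : visits T <= B.
  by rewrite leNgt; apply/negP => /ltW le_B; apply: bounded; exists T.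
have B_ge0 : 0 <= B by rewrite (le_trans _ (visits_lt 0%N)) // /visits big_geq.
pose M := (Num.truncn (2 * B)).+1.
have M_gt0 : 0 < M%:R :> R by rewrite ltr0n.
have ltBM : 2 * B < M%:R by rewrite truncnS_gt.
(* The parabola x (2M - x), continued by its maximum beyond x = M. *)
pose g x : R := (minn x M)%:R * (2 * M%:R - (minn x M)%:R).
have g_le x : g x <= M%:R * M%:R.
  rewrite -subr_ge0; have -> : M%:R * M%:R - g x = (M%:R - (minn x M)%:R) ^+ 2.
    by rewrite /g; ring.
  exact: sqr_ge0.
have gE x : (x <= M)%N -> g x = x%:R * (2 * M%:R - x%:R).
  by rewrite /g => /minn_idPl ->.
pose b x : R := (2 * M%:R * (x == 0%N)%:R + -1) + M%:R^-1 * x%:R.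
have bound T : T%:R <= 4 * M%:R * B.
  have drift n x : (0 < n)%N -> (x <= n)%N -> level_step n g x <= g x + b x.
    move=> n_gt0 le_xn; rewrite /level_step; have [le_Mx|lt_xM] := leqP M x.
      have gx : g x = M%:R * M%:R by rewrite /g (minn_idPr le_Mx); ring.
      have b_ge0 : 0 <= b x.
        rewrite /b -addrA addr_ge0 ?mulr_ge0 // addrC subr_ge0.
        by rewrite mulrC ler_pdivlMr // mul1r ler_nat.
      apply: (@le_trans _ _ (M%:R * M%:R)); last by rewrite gx lerDl.
      do 2?[case: ifP => _; first exact: g_le].
      have -> : M%:R * M%:R = p * (M%:R * M%:R) + q * (M%:R * M%:R).
        by rewrite -mulrDl pDq mul1r.
      by apply: lerD; rewrite ler_wpM2l ?g_le // ltW.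
    case: x le_xn lt_xM => [|x] le_xn lt_xM.
      by rewrite /= /b !gE //= mulr0 mulr1; lra.
    have lt_xMR : x.+1%:R + 1 <= M%:R :> R by rewrite natr1 ler_nat.
    have x_ge0 : 0 <= M%:R^-1 * x.+1%:R :> R by rewrite mulr_ge0 // invr_ge0 ltW.
    rewrite /= /b mulr0 add0r !gE ?(ltnW lt_xM) ?(ltnW (ltnW lt_xM)) //.
    move: lt_xMR x_ge0; rewrite -[x.+2%:R]natr1 -[x.+1%:R]natr1.
    set y := M%:R^-1 * _ => lt_xMR y_ge0.
    case: eqP => _; first by nra.
    have pE : p = 1 - q by rewrite -pDq addrK.
    have : 0 <= (q - p) * (M%:R - (x%:R + 1)).
      by rewrite mulr_ge0 // subr_ge0; lra.
    rewrite pE; nra.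
  have ge0 : 0 <= expect T (fun u => g (size u)).
    rewrite -[leLHS](expect_cst hX T); apply: le_expect => u _.
    rewrite /g mulr_ge0 // subr_ge0.
    have : (minn (size u) M)%:R <= M%:R :> R by rewrite ler_nat geq_minr.
    lra.
  have := le_trans ge0 (level_drift T drift (fun _ _ _ _ => lexx _)).
  have -> : g 0%N = 0 by rewrite gE // mul0r.
  rewrite add0r => sum_ge0.
  have : 0 <= \sum_(0 <= t < T)
      (2 * M%:R * law Pr X t root + (- 1 + M%:R^-1 * B)).
    apply: le_trans sum_ge0 _; apply: ler_sum_nat => t _.
    rewrite /b expectD expect_visit expectZ -addrA.
    do 2!apply: lerD => //; rewrite ler_wpM2l ?invr_ge0 ?(ltW M_gt0) //.
    exact: le_trans (expect_level_ub _ rho_ge1) (visits_lt _).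
  rewrite big_split /= -mulr_sumr -/(visits T) sumr_const_nat subn0 -mulr_natr.
  have : M%:R^-1 * B <= 2^-1 by rewrite mulrC ler_pdivrMr //; lra.
  have := visits_lt T; have : 0 <= T%:R :> R by [].
  nra.
have := bound (Num.truncn (4 * M%:R * B)).+1.
by rewrite leNgt truncnS_gt.
Qed.

Lemma visits_unbounded_series :
  (forall B, exists T, B <= visits T) <->
  (forall B, exists N, B <= \sum_(1 <= n < N) (dur n)%:R * rho ^+ n).
Proof.
have rn_ge0 n : 0 <= rho ^+ n by rewrite exprn_ge0 // ltW.
have [rho_ge1|rho_lt1] := leP 1 rho.
  split=> _ B; last exact: visits_unbounded.
  have [N le_N] := phase_end_unbounded hdur (Num.truncn B).+1.
  exists N.+1; rewrite -(sum_phase hdur (fun n => rho ^+ n)).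
  apply: (@le_trans _ _ (\sum_(0 <= t < phase_end dur N) 1)).
    rewrite sumr_const_nat subn0; apply: le_trans (ltW (truncnS_gt B)) _.
    by rewrite ler_nat.
  by apply: ler_sum => t _; rewrite exprn_ege1.
split=> unbounded B.
  have [T le_T] := unbounded ((1 - rho)^-1 + rho^-1 * B).
  have := le_trans le_T (visits_ub T rho_lt1).
  rewrite lerD2l ler_pM2l ?invr_gt0 // => le_B.
  have [N le_TN] := phase_end_unbounded hdur T.
  exists N.+1; rewrite -(sum_phase hdur (fun n => rho ^+ n)).
  apply: (le_trans le_B); rewrite [leRHS](big_cat_nat (n := T)) //= lerDl.
  exact: sumr_ge0.
have pq_gt0 : 0 < p - q.
  by rewrite subr_gt0 -rhopE -[ltRHS]mul1r ltr_pM2r.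
have [N le_N] := unbounded ((2 * rho * B +
  ((ph 0)%:R + rho / (1 - rho) + 2 * rho / (1 - rho))) / (p - q)).
exists (phase_end dur N.-1); move: le_N.
have -> : \sum_(1 <= n < N) (dur n)%:R * rho ^+ n =
    \sum_(1 <= n < N.-1.+1) (dur n)%:R * rho ^+ n.
  by case: N => //; rewrite !big_geq.
rewrite -(sum_phase hdur (fun n => rho ^+ n)) ler_pdivrMr // [leRHS]mulrC => le_N.
have := le_trans le_N (visits_lb _ rho_lt1).
by rewrite lerD2r ler_pM2l // mulr_gt0.
Qed.

Lemma recurrent_visits :
  recurrent Pr X root <-> forall B, exists T, B <= visits T.
Proof.
have lawE t : return_prob Pr X root t = (law Pr X t root)%:E.
  by apply: probE; case: hX.
rewrite /recurrent (eq_eseriesr (fun t _ => lawE t)).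
rewrite nneseries_pinfty; last by move=> t; exact: prob_ge0.
(* The series starts at time 1, whereas [visits] counts time 0 as well. *)
have visitsE N : visits N.+1 = 1 + \sum_(1 <= t < N.+1) law Pr X t root.
  by rewrite /visits big_ltn // (law_start hX) eqxx.
split=> unbounded B.
  have [N le_N] := unbounded B; exists N.
  apply: le_trans le_N _; case: N => [|N]; first by rewrite /visits !big_geq.
  by rewrite visitsE lerDr.
have [[|T] le_T] := unbounded (B + 1).
  by exists 0%N; move: le_T; rewrite /visits !big_geq //; lra.
by exists T.+1; move: le_T; rewrite visitsE addrC lerD2l.
Qed.

End TreeWalk.

Theorem theorem4p2 (R : realType) (k : nat) (lambda : R)
    (hk : (2 <= k)%N) (hlambda : 0 < lambda)
    (dur : nat -> nat)
    (hdur : (phase_end dur n @[n --> \oo] --> \oo)%classic)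
    (d : measure_display) (Omega : measurableType d)
    (Pr : probability Omega R) (X : nat -> Omega -> seq 'I_k)
    (hX : is_walk Pr (tree_rwogg hk hlambda hdur) (tree_root k) X) :
  ((\sum_(1 <= n <oo) ((dur n)%:R * (lambda / k%:R) ^+ n)%:E = +oo)%E ->
    recurrent Pr X (tree_root k)) /\
  ((\sum_(1 <= n <oo) ((dur n)%:R * (lambda / k%:R) ^+ n)%:E <> +oo)%E ->
    transient Pr X (tree_root k)).

Proof.
have rho_gt0 : 0 < lambda / k%:R by rewrite divr_gt0 // ltr0n ltnW.
have seriesP :
    (\sum_(1 <= n <oo) ((dur n)%:R * (lambda / k%:R) ^+ n)%:E = +oo)%E <->
    recurrent Pr X (tree_root k).
  rewrite nneseries_pinfty => [|n]; last by rewrite mulr_ge0 // exprn_ge0 // ltW.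
  by rewrite (recurrent_visits hX) (visits_unbounded_series hX).
by split=> [/seriesP|not_oo /seriesP].
Qed.
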